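(* Let $A\subset\mathbb{R}$ be a subring with $\mathbb{Q}\subset A$, $(X,D)$ a smooth projective complex variety with a normal crossing divisor, and $p$ an integer. The morphism of complexes $$ev:P^n_{\mathcal D}(X,D,A(p))\to C^n_{\mathcal D}(X,D,A(p)),\qquad w\otimes T\mapsto\Big(w(0)T,\;w(1)T,\;\int_{[0,1]}w\cdot T\Big)$$ is a quasi-isomorphism. A quasi-inverse is induced by the maps $$s:C^n_{\mathcal D}(X,D,A(p))\to P^n_{\mathcal D}(X,D,A(p)),\qquad(a,b,c)\mapsto(1-x)\otimes a+x\otimes b+dx\otimes c.$$
   Context: Currents. $\mathcal D^k(X)=\bigoplus_{r+s=k}\mathcal D^{r,s}(X)$ is the space of currents of degree $k$ on $X$ ($\mathcal D^{r,s}$: currents vanishing on test forms of bidegree $\neq(m-r,m-s)$, $m=\dim_{\mathbb C}X$), $dT(\eta)=(-1)^{\deg T+1}T(d\eta)$. $\mathcal D(X,\log D)=\mathcal D(X)/\mathcal D(X,\mathrm{on}\,D)$, where $\mathcal D(X,\mathrm{on}\,D)$ consists of the currents vanishing on all smooth test forms that restrict to $0$ on $D_{\mathrm{reg}}$; $F^p$ is the Hodge filtration $\bigoplus_{r\ge p}\mathcal D^{r,s}$. $\mathcal I(X,D,A(p))$, $A(p)=(2\pi i)^pA$, is the complex of relative integral currents (Federer–Fleming integral currents on $X$ modulo those supported in $D$) with coefficients in $A(p)$; it is regarded as included in $\mathcal D(X,\log D)$. $C_{\mathcal D}(X,D,A(p))=\mathrm{Tot}\big(\mathcal I(X,D,A(p))\oplus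 F^p\mathcal D(X,\log D)\xrightarrow{-\delta+\iota}\mathcal D(X,\log D)\big)$ with $\delta,\iota$ the inclusions: elements of degree $n$ are triples $(a,b,c)$ with $a\in\mathcal I^n$, $b\in F^p\mathcal D^n$, $c\in\mathcal D^{n-1}$, and $d(a,b,c)=(da,db,-a+b-dc)$. $\Omega_A(x)$ is the free graded-commutative differential graded $A$-algebra on one variable $x$ of degree $0$ (polynomial forms on the $1$-simplex). $P^\bullet_{\mathcal D}(X,D,A(p))$ is the subcomplex of those $P\in\Omega_A(x)\otimes_A\mathcal D(X,\log D)$ with $P|_{x=0}\in\mathcal I(X,D,A(p))$ and $P|_{x=1}\in F^p\mathcal D(X,\log D)$, where evaluation at $x=\epsilon$ sends $x\mapsto\epsilon$, $dx\mapsto0$. The formula for $ev$ is extended additively to sums $\sum w_i\otimes T_i$; $w(\epsilon)$ denotes evaluation at $x=\epsilon$ and $\int_{[0,1]}w$ is the integral of the $1$-form part of $w$. *)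

(* Defs.v *)
From mathcomp Require Import all_boot all_order all_algebra.
From mathcomp Require Import all_classical all_reals all_analysis.
From mathcomp Require Import complex.
From mathcomp Require mpoly.
From Stdlib Require List.

Set Implicit Arguments.
Unset Strict Implicit.
Unset Printing Implicit Defensive.

Import Order.TTheory GRing.Theory Num.Theory.
Import numFieldNormedType.Exports.

Local Open Scope classical_set_scope.
Local Open Scope ring_scope.
Local Open Scope complex_scope.

(** Conventions.  A closed subset of P^N(C) is represented by the set of its
    homogeneous coordinate vectors, a C^*-stable subset of C^(N+1) \ {0}.
    A differential form on P^N is represented by its pull-back to
    C^(N+1) \ {0}, i.e. by a basic (C^*-invariant and horizontal) form there.
    As a closed submanifold X of P^N is compact, every smooth form on X is the
    restriction of one on P^N and has compact support, and the C^oo topology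
    on forms of X is the quotient topology.  Hence a current on X is a
    continuous linear functional on forms of P^N that kills the forms
    restricting to 0 on X. *)

Section RealCalculus.
Variable R : realType.
(* The topology and the norm are attached to numFieldType structures. *)
Local Notation C := (R[i] : numFieldType).

Definition cderive (g : R -> C) : C :=
  Complex (derive1 (fun h => complex.Re (g h)) 0)
          (derive1 (fun h => complex.Im (g h)) 0).

Definition cderivable (g : R -> C) : Prop :=
  derivable (fun h => complex.Re (g h)) 0 1 /\
  derivable (fun h => complex.Im (g h)) 0 1.

(* Derivative along v for the real structure of C^n. *)
Definition dird n (f : 'rV[C]_n -> C) (x v : 'rV[C]_n) : C :=
  cderive (fun h => f (x + h%:C *: v)).

Definition dirds n (ws : seq 'rV[C]_n) (f : 'rV[C]_n -> C) :=
  foldr (fun w g => fun x => dird g x w) f ws.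

Definition continuous_at n (f : 'rV[C]_n -> C) x : Prop :=
  {for x, continuous f}.

(* For open U: all iterated real directional derivatives exist and are
   continuous on U. *)
Definition smooth n (U : set 'rV[C]_n) (f : 'rV[C]_n -> C) : Prop :=
  forall ws w x, U x ->
    continuous_at (dirds ws f) x /\
    cderivable (fun h => dirds ws f (x + h%:C *: w)).

Definition partial_deriv k n (sigma : 'rV[R]_k -> 'rV[C]_n) (t : 'rV[R]_k)
    (l : 'I_k) : 'rV[C]_n :=
  \row_c cderive (fun h => sigma (t + h *: delta_mx 0 l) 0 c).

Fixpoint cube_integral k : ('rV[R]_k -> R) -> R :=
  match k with
  | 0 => fun F => F 0
  | k'.+1 => fun F => \int[lebesgue_measure]_(t in `[0, 1])
      cube_integral (fun y : 'rV[R]_k' => F (row_mx (t%:M : 'rV[R]_1) y))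
  end.

End RealCalculus.

Section Forms.
Variables (R : realType) (N : nat).
Local Notation C := (R[i] : numFieldType).
Local Notation V := 'rV[C]_N.+1.

(* omega x [:: v_1; ...; v_j]; on a form of degree j only the values on lists
   of length j are relevant. *)
Definition form := V -> seq V -> C.

Definition test_form (j : nat) (omega : form) : Prop :=
  [/\ forall vs, size vs = j -> smooth [set x | x != 0] (omega^~ vs),
      forall x vs1 vs2 (a : R) v w, x != 0 -> (size vs1 + (size vs2).+1 = j)%N ->
        omega x (vs1 ++ (a%:C *: v + w) :: vs2) =
        a%:C * omega x (vs1 ++ v :: vs2) + omega x (vs1 ++ w :: vs2),
      forall x vs, x != 0 -> size vs = j -> ~~ uniq vs -> omega x vs = 0,
      forall (a : C) x vs, x != 0 -> a != 0 -> size vs = j ->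
        omega (a *: x) [seq a *: v | v <- vs] = omega x vs
    & forall (a : C) x vs, x != 0 -> (size vs).+1 = j ->
        omega x (a *: x :: vs) = 0].

Definition extd (omega : form) : form := fun x vs =>
  \sum_(l < size vs)
    (-1) ^+ l * dird (fun y => omega y (take l vs ++ drop l.+1 vs)) x
                     (nth 0 vs l).

Definition pullback m (phi : 'rV[C]_m -> V) (omega : form)
    (z : 'rV[C]_m) (us : seq 'rV[C]_m) : C :=
  omega (phi z) [seq 'd phi z u | u <- us].

End Forms.

Section Geometry.
Variables (R : realType) (N : nat).
Local Notation C := (R[i] : numFieldType).
Local Notation V := 'rV[C]_N.+1.

Definition projective_set (X : set V) : Prop :=
  exists fs : seq {d : nat & mpoly.dhomog N.+1 C d},
    forall x, X x <->
      x != 0 /\ List.Forall (fun f : {d : nat & mpoly.dhomog N.+1 C d} =>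
        mpoly.meval (fun c => x 0 c) (mpoly.mpoly_of_dhomog (tagged f)) = 0) fs.

(* phi lifts to C^(N+1) \ {0} the inverse [phi] : W -> X of a holomorphic
   chart of X: [phi] is holomorphic, immersive (the tangent space of P^N at [x]
   is C^(N+1) / C x), injective, and open onto its image. *)
Definition chart (X : set V) m (W : set 'rV[C]_m) (phi : 'rV[C]_m -> V) : Prop :=
  [/\ open W,
      forall z, W z -> X (phi z) /\ differentiable phi z,
      forall z u (a : C), W z -> 'd phi z u = a *: phi z -> u = 0,
      forall z z' (a : C), W z -> W z' -> phi z' = a *: phi z -> z = z'
    & forall W', open W' -> W' `<=` W -> exists2 U : set V, open U &
        [set x | exists z (a : C), [/\ W' z, a != 0 & x = a *: phi z]]
          = X `&` U].

(* X is a smooth projective variety of pure dimension m. *)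
Definition smooth_projective (m : nat) (X : set V) : Prop :=
  projective_set X /\
  forall x, X x -> exists W (phi : 'rV[C]_m -> V),
    chart X W phi /\ exists z (a : C), [/\ W z, a != 0 & x = a *: phi z].

(* Near each of its points, D is the locus z_1 ... z_k = 0 in suitable local
   holomorphic coordinates of X centred at that point. *)
Definition normal_crossing_divisor (m : nat) (X D : set V) : Prop :=
  [/\ projective_set D, D `<=` X &
      forall x, D x -> exists W (phi : 'rV[C]_m -> V) (k : nat),
        [/\ chart X W phi, W 0,
            exists2 a : C, a != 0 & x = a *: phi 0,
            (k <= m)%N &
            forall z, W z -> D (phi z) <-> \prod_(l < m | (l < k)%N) z 0 l = 0]].

Definition restricts_to_zero (m : nat) (X : set V) (j : nat) (omega : form R N) :=
  forall W (phi : 'rV[C]_m -> V), chart X W phi ->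
  forall z us, W z -> size us = j -> pullback phi omega z us = 0.

(* D_reg is covered by the charts of X in which D is a coordinate hyperplane
   z_l = 0, and there its tangent space is u_l = 0. *)
Definition restricts_to_zero_on_reg (m : nat) (X D : set V) (j : nat)
    (omega : form R N) :=
  forall W (phi : 'rV[C]_m -> V) (l : 'I_m), chart X W phi ->
  (forall z, W z -> D (phi z) <-> z 0 l = 0) ->
  forall z us, W z -> z 0 l = 0 -> size us = j ->
    (forall u : 'rV[C]_m, u \in us -> u 0 l = 0) -> pullback phi omega z us = 0.

(* Value of dz_I1 /\ ... /\ dz_Ia /\ dzbar_J1 /\ ... /\ dzbar_Jb on us. *)
Definition dz_wedge m a b (I : {ffun 'I_a -> 'I_m}) (J : {ffun 'I_b -> 'I_m})
    (us : seq 'rV[C]_m) : C :=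
  \det (\matrix_(r < a + b, l < a + b)
    match fintype.split r with
    | inl s => (nth 0 us l) 0 (I s)
    | inr s => conjc ((nth 0 us l) 0 (J s))
    end).

(* The restriction of omega to X has bidegree (a, b). *)
Definition bidegree (m : nat) (X : set V) (a b : nat) (omega : form R N) :=
  forall W (phi : 'rV[C]_m -> V), chart X W phi -> forall z, W z ->
  exists c : {ffun 'I_a -> 'I_m} -> {ffun 'I_b -> 'I_m} -> C,
    forall us, size us = (a + b)%N ->
      pullback phi omega z us = \sum_I \sum_J c I J * dz_wedge I J us.

End Geometry.

Section Currents.
Variables (R : realType) (N m : nat) (X D : set 'rV[R[i] : numFieldType]_N.+1).
Local Notation C := (R[i] : numFieldType).
Local Notation V := 'rV[C]_N.+1.

(* Functionals on forms.  Only the values on test forms of the relevant degree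
   matter: equality of currents is agreement on those, see log_eq. *)
Definition functional := form R N -> C.

(* C^r-boundedness on the unit sphere controls a basic form, hence these are
   the seminorms defining the C^oo topology on forms of P^N. *)
Definition Cr_bounded (r j : nat) (B : C) (omega : form R N) : Prop :=
  forall x ws vs, `|x| = 1 -> (size ws <= r)%N -> size vs = j ->
    (forall v, v \in ws ++ vs -> `|v| <= 1) ->
    `|dirds ws (omega^~ vs) x| <= B.

(* T is a current of degree k on X: a continuous linear functional on the
   smooth forms of degree j = 2m - k of X.  For k > 2m there is no such j, and
   D^k(X) = 0. *)
Definition is_current (k : int) (T : functional) : Prop :=
  forall j : nat, j%:Z + k = (2 * m)%:Z ->
  [/\ forall (a : C) omega eta, test_form j omega -> test_form j eta ->
        T (a *: omega + eta) = a * T omega + T eta,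
      exists (r : nat) (K : C), forall omega (B : C), test_form j omega ->
        Cr_bounded r j B omega -> `|T omega| <= K * B
    & forall omega, test_form j omega -> restricts_to_zero m X j omega ->
        T omega = 0].

Definition cur_d (k : int) (T : functional) : functional :=
  fun eta => (-1) ^ (k + 1) * T (extd eta).

(* The currents of degree k with this property form D^k(X, on D). *)
Definition on_D (k : int) (T : functional) : Prop :=
  forall (j : nat) eta, j%:Z + k = (2 * m)%:Z -> test_form j eta ->
    restricts_to_zero_on_reg m X D j eta -> T eta = 0.

(* Equality in D^k(X, log D) = D^k(X) / D^k(X, on D). *)
Definition log_eq (k : int) (T T' : functional) : Prop := on_D k (T - T').

Definition current_of_type (r s : int) (T : functional) : Prop :=
  is_current (r + s) T /\
  forall (a b : nat) eta, (a + b)%:Z + (r + s) = (2 * m)%:Z ->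
    test_form (a + b) eta -> bidegree m X a b eta ->
    (a%:Z, b%:Z) != (m%:Z - r, m%:Z - s) -> T eta = 0.

(* Representatives of F^p D^k(X, log D). *)
Definition hodge_F (p k : int) (T : functional) : Prop :=
  is_current k T /\
  exists (rs : seq int) (S : int -> functional),
    (forall r, r \in rs -> p <= r /\ current_of_type r (k - r) (S r)) /\
    log_eq k T (\sum_(r <- rs) S r).

(* Subdividing cubes, a Lipschitz map from a cube to X in P^N lifts piecewise
   to a Lipschitz map to C^(N+1) \ {0}; so the chains of these cubes are all
   the integral Lipschitz chains of X. *)
Definition lipschitz_cube k (sigma : 'rV[R]_k -> V) : Prop :=
  (exists L : R, forall s t : 'rV[R]_k, `|sigma s - sigma t| <= (L * `|s - t|)%:C) /\
  forall t : 'rV[R]_k, (forall l, 0 <= t 0 l <= 1) -> X (sigma t).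

(* Push-forward of the unit cube by (the map to X defined by) sigma; the
   partial derivatives exist almost everywhere. *)
Definition cube_current k (sigma : 'rV[R]_k -> V) : functional := fun omega =>
  let f := fun t => omega (sigma t) [seq partial_deriv sigma t l | l : 'I_k] in
  Complex (cube_integral (fun t => complex.Re (f t)))
          (cube_integral (fun t => complex.Im (f t))).

Definition lipschitz_chain k (T : functional) : Prop :=
  exists cs : seq (int * ('rV[R]_k -> V)),
    List.Forall (fun c => lipschitz_cube c.2) cs /\
    T = fun omega => \sum_(c <- cs) c.1%:~R * cube_current c.2 omega.

(* Comass at most 1 (with respect to a norm equivalent to the one of the
   Fubini-Study metric, which does not change the closure below). *)
Definition comass_le1 (j : nat) (omega : form R N) : Prop :=
  forall x vs, x != 0 -> size vs = j -> (forall v, v \in vs -> `|v| <= `|x|) ->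
    `|omega x vs| <= 1.

(* T is a current of dimension j in the closure, for the mass norm, of the
   integral Lipschitz chains. *)
Definition rectifiable (j : nat) (T : functional) : Prop :=
  is_current ((2 * m)%:Z - j%:Z) T /\
  forall eps : R, 0 < eps -> exists2 S, lipschitz_chain j S &
    forall omega, test_form j omega -> comass_le1 j omega ->
      `|T omega - S omega| <= eps%:C.

(* Federer-Fleming: T and its boundary are rectifiable. *)
Definition integral_current (k : int) (T : functional) : Prop :=
  is_current k T /\
  forall j : nat, j%:Z + k = (2 * m)%:Z ->
    rectifiable j T /\
    forall j', j = j'.+1 -> rectifiable j' (fun eta => T (extd eta)).

Definition twist (p : int) : C := ((2 * pi)%:C * 'i) ^ p.

(* Representatives of I^k(X, D, A(p)), as a subgroup of D^k(X, log D): the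
   classes of the A(p)-linear combinations of integral currents.  An integral
   current lies in D(X, on D) if and only if its support is contained in D. *)
Definition rel_integral (A : {pred R}) (p k : int) (T : functional) : Prop :=
  is_current k T /\
  exists ts : seq (R * functional),
    List.Forall (fun t => t.1 \in A /\ integral_current k t.2) ts /\
    log_eq k T (\sum_(t <- ts) (t.1%:C * twist p) *: t.2).

End Currents.

(** Complexes of modules over a subring of R, given degreewise by
    representatives (mem_cplx n) modulo an equivalence (eqv n).  The record
    only carries the data; in degree n the cohomology is the group of cocycles
    modulo the relation cohomologous. *)
Record cplx (R : pzRingType) := Cplx {
  car : Type;
  mem_cplx : int -> car -> Prop;
  eqv : int -> car -> car -> Prop;
  zero_cplx : car;
  add_cplx : car -> car -> car;
  scale_cplx : R -> car -> car;
  dif : int -> car -> car }.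

Section Cohomology.
Variables (R : pzRingType) (A : {pred R}).

Definition cocycle (K : cplx R) n (u : car K) : Prop :=
  mem_cplx n u /\ eqv (n + 1) (dif n u) (zero_cplx K).

Definition cohomologous (K : cplx R) n (u v : car K) : Prop :=
  exists2 w, mem_cplx (n - 1) w & eqv n u (add_cplx v (dif (n - 1) w)).

Definition cplx_morphism (K L : cplx R) (f : car K -> car L) : Prop :=
  [/\ forall n u, mem_cplx n u -> mem_cplx n (f u),
      forall n u v, mem_cplx n u -> mem_cplx n v -> eqv n u v ->
        eqv n (f u) (f v),
      forall n u v, mem_cplx n u -> mem_cplx n v ->
        eqv n (f (add_cplx u v)) (add_cplx (f u) (f v)),
      forall n a u, a \in A -> mem_cplx n u ->
        eqv n (f (scale_cplx a u)) (scale_cplx a (f u))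
    & forall n u, mem_cplx n u -> eqv (n + 1) (f (dif n u)) (dif n (f u))].

Definition quasi_isomorphism (K L : cplx R) (f : car K -> car L) : Prop :=
  cplx_morphism f /\
  forall n,
    (forall u v, cocycle n u -> cocycle n v ->
       cohomologous n (f u) (f v) -> cohomologous n u v) /\
    (forall c, cocycle n c -> exists2 u, cocycle n u & cohomologous n (f u) c).

(* f and g induce mutually inverse maps in cohomology. *)
Definition quasi_inverse (K L : cplx R) (f : car K -> car L) (g : car L -> car K) :=
  forall n,
    (forall u, cocycle n u -> cohomologous n (g (f u)) u) /\
    (forall c, cocycle n c -> cohomologous n (f (g c)) c).

End Cohomology.

Section Deligne.
Variables (R : realType) (N m : nat) (X D : set 'rV[R[i] : numFieldType]_N.+1).
Variables (A : {pred R}) (p : int).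
Local Notation cur := (functional R N).

Definition C_D : cplx R := {|
  car := cur * cur * cur;
  mem_cplx := fun n '(a, b, c) =>
    [/\ rel_integral m X D A p n a, hodge_F m X D p n b
      & is_current m X (n - 1) c];
  eqv := fun n '(a, b, c) '(a', b', c') =>
    [/\ log_eq m X D n a a', log_eq m X D n b b' & log_eq m X D (n - 1) c c'];
  zero_cplx := (0, 0, 0);
  add_cplx := fun '(a, b, c) '(a', b', c') => (a + a', b + b', c + c');
  scale_cplx := fun r '(a, b, c) => (r%:C *: a, r%:C *: b, r%:C *: c);
  dif := fun n '(a, b, c) =>
    (cur_d n a, cur_d n b, - a + b - cur_d (n - 1) c) |}.

(* A finite sum of tensors w (x) T, with w a polynomial in x. *)
Definition tensors := seq ({poly R} * cur).

Definition tmap (f : {poly R} -> {poly R}) (g : cur -> cur) (u : tensors) : tensors :=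
  [seq (f wT.1, g wT.2) | wT <- u].

(* The linear map w (x) T |-> (phi w) T. *)
Definition contract (phi : {poly R} -> R) (u : tensors) : cur :=
  \sum_(wT <- u) (phi wT.1)%:C *: wT.2.

(* Well-formed sums, with T representing a class of degree k. *)
Definition tensors_in (k : int) (u : tensors) : Prop :=
  List.Forall (fun wT => wT.1 \is a polyOver A /\ is_current m X k wT.2) u.

(* Equality in A[x] (x)_A D^k(X, log D): the coefficients along the A-basis
   (x^l) of A[x] agree. *)
Definition tensors_eq (k : int) (u v : tensors) : Prop :=
  forall l, log_eq m X D k (contract (fun w => w`_l) u) (contract (fun w => w`_l) v).

(* (u0, u1) stands for  sum w (x) T over u0  +  sum (w dx) (x) T over u1. *)
Definition P_D : cplx R := {|
  car := tensors * tensors;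
  mem_cplx := fun n '(u0, u1) =>
    [/\ tensors_in n u0, tensors_in (n - 1) u1,
        rel_integral m X D A p n (contract (horner^~ 0) u0)
      & hodge_F m X D p n (contract (horner^~ 1) u0)];
  eqv := fun n '(u0, u1) '(v0, v1) => tensors_eq n u0 v0 /\ tensors_eq (n - 1) u1 v1;
  zero_cplx := ([::], [::]);
  add_cplx := fun '(u0, u1) '(v0, v1) => (u0 ++ v0, u1 ++ v1);
  scale_cplx := fun r '(u0, u1) => (tmap ( *:%R r) id u0, tmap ( *:%R r) id u1);
  dif := fun n '(u0, u1) =>
    (tmap id (cur_d n) u0,
     tmap (@deriv R) id u0 ++ tmap -%R (cur_d (n - 1)) u1) |}.

Definition ev_map : car P_D -> car C_D := fun '(u0, u1) =>
  (contract (horner^~ 0) u0,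
   contract (horner^~ 1) u0,
   contract (fun w => \int[lebesgue_measure]_(t in `[0, 1]) w.[t]) u1).

Definition s_map : car C_D -> car P_D := fun '(a, b, c) =>
  ([:: (1 - 'X, a); ('X, b)], [:: (1, c)]).

End Deligne.

Arguments ev_map [R N] m X D A p.
Arguments s_map [R N] m X D A p.

(* Main.v *)
(** The composite [ev o s] is the identity.  For [s o ev], let [bubble w] be the
    primitive of [w] corrected by a multiple of x so as to vanish at 0 and 1; then
    [w dx (x) T |-> bubble w (x) T] is a homotopy from [s o ev] to the identity,
    and it takes values in [P_D] because [bubble w] vanishes at both ends and its
    coefficients stay in [A], which contains the rationals.  All identities hold
    for functionals on forms, so neither [d] of a current being a current nor
    [d o d = 0] is needed. *)
Require Import Defs.
From mathcomp Require Import all_boot all_order all_algebra.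
From mathcomp Require Import all_classical all_reals all_analysis.
From mathcomp Require Import complex.
From HB Require Import structures.
From mathcomp Require Import ring.

Import Order.TTheory GRing.Theory Num.Theory numFieldNormedType.Exports.
Set Implicit Arguments.
Unset Strict Implicit.

Local Open Scope classical_set_scope.
Local Open Scope ring_scope.
Local Open Scope complex_scope.

(** * Primitives of polynomials and the bubble operator *)

Section Primitive.
Variable R : realType.
Implicit Types w : {poly R}.

(* The constant coefficient is [w`_0 / 0 = 0]. *)
Definition primitive w : {poly R} := \poly_(i < (size w).+1) (w`_i.-1 / i%:R).

Lemma coef_primitive w i : (primitive w)`_i = w`_i.-1 / i%:R.
Proof.
rewrite coef_poly; case: ltnP => // ltwi.
by rewrite [w`__]nth_default ?mul0r // -ltnS (leq_trans ltwi) // leqSpred.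
Qed.

Fact primitive_is_linear : linear primitive.
Proof.
move=> a v w; apply/polyP => i.
by rewrite coefD coefZ !coef_primitive coefD coefZ mulrDl mulrA.
Qed.
HB.instance Definition _ :=
  GRing.isLinear.Build R {poly R} {poly R} _ primitive primitive_is_linear.

Lemma deriv_primitive w : (primitive w)^`() = w.
Proof.
apply/polyP => i.
by rewrite coef_deriv coef_primitive -mulrnAr -mulr_natr mulVf ?mulr1 ?pnatr_eq0.
Qed.

Lemma primitive_deriv w : primitive w^`() = w - w.[0]%:P.
Proof.
apply/polyP => -[|i]; rewrite coef_primitive coefB coefC /=.
  by rewrite invr0 mulr0 horner_coef0 subrr.
by rewrite subr0 coef_deriv -[_`__ *+ _]mulr_natr mulfK ?pnatr_eq0.
Qed.

Lemma horner_primitive0 w : (primitive w).[0] = 0.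
Proof. by rewrite horner_coef0 coef_primitive invr0 mulr0. Qed.

Lemma primitive1 : primitive 1 = 'X.
Proof. by rewrite -(derivX R) primitive_deriv hornerX subr0. Qed.

(** The fundamental theorem of calculus makes the integral in [ev_map] a composite of linear maps on
    polynomials, so that it can be treated as a [{scalar {poly R}}], like the two evaluations. *)
Lemma Rintegral_horner w :
  \int[lebesgue_measure]_(t in `[0, 1]) w.[t] = (primitive w).[1].
Proof.
rewrite /Rintegral (@continuous_FTC2 _ _ (horner (primitive w))) //.
- by rewrite horner_primitive0 sube0.
- by apply: continuous_subspaceT; exact: continuous_horner.
- split; first by move=> x _; exact: derivable_horner.
  + by apply: cvg_at_right_filter; exact: continuous_horner.
  + by apply: cvg_at_left_filter; exact: continuous_horner.
- by move=> x _; rewrite -derivE deriv_primitive.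
Qed.

Definition bubble w : {poly R} := primitive w - (primitive w).[1] *: 'X.

Fact bubble_is_linear : linear bubble.
Proof.
move=> a v w; rewrite /bubble linearP hornerD hornerZ scalerDl scalerBr scalerA.
by rewrite opprD addrACA.
Qed.
HB.instance Definition _ :=
  GRing.isLinear.Build R {poly R} {poly R} _ bubble bubble_is_linear.

Lemma bubble0 w : (bubble w).[0] = 0.
Proof. by rewrite !hornerE horner_primitive0 subrr. Qed.

Lemma bubble1 w : (bubble w).[1] = 0.
Proof. by rewrite !hornerE subrr. Qed.

(** The constant removed is the integral of [w] over [0, 1], which is the [dx]-coefficient of the
    image of [w dx] under [s o ev]. *)
Lemma deriv_bubble w : (bubble w)^`() = w - (primitive w).[1]%:P.
Proof. by rewrite derivB deriv_primitive derivZ derivX alg_polyC. Qed.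

(** The term subtracted from [w] is its affine interpolation at 0 and 1, which is its image under
    [s o ev]. The difference vanishes at both ends, where [bubble] inverts the derivative, and
    [bubble] kills the constant derivative of the affine term. *)
Lemma bubble_deriv w : bubble w^`() = w - (w.[0] *: (1 - 'X) + w.[1] *: 'X).
Proof.
rewrite /bubble primitive_deriv !hornerE scalerBr scalerBl -alg_polyC.
by rewrite -addrA -opprD; congr (_ - _); rewrite [RHS]addrAC addrA.
Qed.

Variable A : subringClosed R.
Hypothesis hQA : forall q : rat, (ratr q : R) \in A.

Lemma bubble_polyOver w : w \is a polyOver A -> bubble w \is a polyOver A.
Proof.
move=> /polyOverP Aw.
have Ap : primitive w \is a polyOver A.
  apply/polyOverP => i; rewrite coef_primitive rpredM //.
  (* This covers [i = 0] too, since the inverse of 0 is 0 both in [rat] and in [R]. *)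
  by have := hQA i%:R^-1; rewrite fmorphV rmorph_nat.
by rewrite rpredB // polyOverZ ?polyOverX // rpred_horner // rpred1.
Qed.

End Primitive.

(** * Linear algebra of currents and of contracted tensors *)

Section Currents.
Variables (R : realType) (N m : nat) (X D : set 'rV[R[i]]_N.+1).
Local Notation cur := (functional R N).
Local Notation contract := Defs.contract.
Implicit Types (T S : cur) (u v : tensors R N) (phi psi : {poly R} -> R).

Lemma functionalD T S eta : (T + S) eta = T eta + S eta. Proof. by []. Qed.

Lemma functionalZ (a : R[i]) T eta : (a *: T) eta = a * T eta. Proof. by []. Qed.

Definition functionalE := (functionalD, functionalZ).

Lemma is_current_lin k (a : R[i]) T S :
  is_current m X k T -> is_current m X k S -> is_current m X k (a *: T + S).
Proof.
move=> cT cS j jk; have [linT [r [K TK]] T0] := cT j jk.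
have [linS [r' [K' SK']] S0] := cS j jk.
split=> [b om et tom tet||om tom om0].
- rewrite !functionalE (linT _ _ _ tom tet) (linS _ _ _ tom tet).
  by ring.
(* A bound up to order [maxn r r'] is also one up to [r] and up to [r'], so both continuity
   estimates apply with the same [B]. *)
- exists (maxn r r'), (`|a| * K + K') => om B tom bom.
  have bounded_le s : (s <= maxn r r')%N -> Cr_bounded s j B om.
    move=> lesr x ws vs x1 szws; apply: bom => //; exact: leq_trans lesr.
  rewrite (le_trans (ler_normD _ _)) // mulrDl lerD //.
    rewrite normrM -mulrA ler_wpM2l // TK //.
    by apply: bounded_le; exact: leq_maxl.
  by rewrite SK' //; apply: bounded_le; exact: leq_maxr.
- by rewrite !functionalE T0 // S0 // mulr0 addr0.
Qed.

Lemma is_current0 k : is_current m X k (0 : cur).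
Proof.
move=> j jk; split=> [a om et _ _||//]; first by rewrite /= mulr0 addr0.
by exists 0%N, 0 => om B _ _; rewrite normr0 mul0r.
Qed.

Lemma on_D0 k : on_D m X D k (0 : cur).
Proof. by []. Qed.

Lemma on_D_lin k (a : R[i]) T S :
  on_D m X D k T -> on_D m X D k S -> on_D m X D k (a *: T + S).
Proof.
move=> dT dS j eta jk teta eta0.
by rewrite !functionalE (dT j) // (dS j) // mulr0 addr0.
Qed.

Lemma rel_integral0 (A : {pred R}) p k : rel_integral m X D A p k (0 : cur).
Proof.
split; first exact: is_current0.
by exists [::]; split=> //; rewrite /log_eq big_nil subrr.
Qed.

Lemma hodge_F0 p k : hodge_F m X D p k (0 : cur).
Proof.
split; first exact: is_current0.
by exists [::], (fun=> 0); split=> //; rewrite /log_eq big_nil subrr.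
Qed.

Lemma cur_dZ k (a : R[i]) T : cur_d k (a *: T) = a *: cur_d k T.
Proof.
by apply/funext => eta; rewrite /cur_d !functionalE mulrCA.
Qed.

Lemma cur_dD k T S : cur_d k (T + S) = cur_d k T + cur_d k S.
Proof. by apply/funext => eta; rewrite /cur_d !functionalE mulrDr. Qed.

Lemma cur_dN k T : cur_d k (- T) = - cur_d k T.
Proof. by rewrite -scaleN1r cur_dZ scaleN1r. Qed.

Lemma cur_d0 k : cur_d k (0 : cur) = 0.
Proof. by apply/funext => eta; rewrite /cur_d mulr0. Qed.

Lemma contract_nil phi : contract phi [::] = 0 :> cur.
Proof. exact: big_nil. Qed.

Lemma contract_cons phi w T u :
  contract phi ((w, T) :: u) = (phi w)%:C *: T + contract phi u.
Proof. exact: big_cons. Qed.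

Lemma contract_cat phi u v : contract phi (u ++ v) = contract phi u + contract phi v.
Proof. exact: big_cat. Qed.

Lemma eq_contract phi psi u : phi =1 psi -> contract phi u = contract psi u.
Proof. by move=> eq_phi; apply: eq_bigr => wT _; rewrite eq_phi. Qed.

(** Since the weights are arbitrary functions, several contractions of one list fold into a single
    one, and an identity of functionals reduces to a pointwise identity of weights through
    [eq_contract]. *)
Lemma contract_lin (a : R) phi psi u :
  contract (fun w => a * phi w + psi w) u = a%:C *: contract phi u + contract psi u.
Proof.
rewrite /contract scaler_sumr -big_split; apply: eq_bigr => wT _.
by rewrite rmorphD rmorphM scalerDl scalerA.
Qed.

Lemma contract0 u : contract (fun=> 0) u = 0.
Proof. by apply: big1 => wT _; rewrite rmorph0 scale0r. Qed.

Lemma contract_tmapl phi f u : contract phi (tmap f id u) = contract (phi \o f) u.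
Proof. by rewrite /contract big_map. Qed.

Lemma contract_tmapr phi f k u :
  contract phi (tmap f (cur_d k) u) = cur_d k (contract (phi \o f) u).
Proof.
elim: u => [|[w T] u IHu]; first by rewrite !contract_nil cur_d0.
by rewrite /= !contract_cons IHu cur_dD cur_dZ.
Qed.

Lemma scalar_poly (phi : {scalar {poly R}}) M (w : {poly R}) :
  (size w <= M)%N -> phi w = \sum_(l < M) phi 'X^l * w`_l.
Proof.
move=> szw; have {1}-> : w = \sum_(l < M) w`_l *: 'X^l.
  rewrite -poly_def; apply/polyP => i; rewrite coef_poly.
  by case: ltnP => // leMi; rewrite nth_default // (leq_trans szw).
by rewrite linear_sum; apply: eq_bigr => l _; rewrite linearZ /= mulrC.
Qed.

(** A linear functional on polynomials is determined by its values on monomials. Every large [M] is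
    allowed, so that two lists can be expanded over a common range. *)
Lemma contract_coef (phi : {scalar {poly R}}) u : exists M0, forall M, (M0 <= M)%N ->
  contract phi u = \sum_(l < M) (phi 'X^l)%:C *: contract (fun w => w`_l) u.
Proof.
elim: u => [|[w T] u [M0 IHu]].
  by exists 0%N => M _; rewrite contract_nil big1 // => l _; rewrite contract_nil scaler0.
exists (maxn (size w) M0) => M; rewrite geq_max => /andP[leM leM0].
rewrite contract_cons (IHu M) // (scalar_poly phi leM) // rmorph_sum scaler_suml.
rewrite -big_split; apply: eq_bigr => l _.
by rewrite contract_cons scalerDr scalerA rmorphM.
Qed.

(** As [tensors_eq] compares coefficients only, this is what makes evaluation, integration and
    [bubble] well defined on classes. *)
Lemma log_eq_contract (phi : {scalar {poly R}}) k u v :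
  tensors_eq m X D k u v -> log_eq m X D k (contract phi u) (contract phi v).
Proof.
move=> eq_uv; have [Mu uE] := contract_coef phi u; have [Mv vE] := contract_coef phi v.
rewrite (uE (maxn Mu Mv)) ?leq_maxl // (vE (maxn Mu Mv)) ?leq_maxr //.
rewrite /log_eq -sumrB; elim/big_rec: _ => [|l T _ dT]; first exact: on_D0.
by rewrite -scalerBr; apply: on_D_lin => //; exact: eq_uv.
Qed.

Lemma contractN phi u : contract (fun w => - phi w) u = - contract phi u.
Proof.
by rewrite /contract -sumrN; apply: eq_bigr => wT _; rewrite rmorphN scaleNr.
Qed.

Lemma is_current_contract phi (A : {pred R}) k u :
  tensors_in m X A k u -> is_current m X k (contract phi u).
Proof.
elim=> [|[w T] {}u [_ cT] _ cu]; first by rewrite contract_nil; exact: is_current0.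
by rewrite contract_cons; exact: is_current_lin.
Qed.

Lemma tensors_in_cat (A : {pred R}) k u v :
  tensors_in m X A k u -> tensors_in m X A k v -> tensors_in m X A k (u ++ v).
Proof. by elim=> //= wT {}u wTin _ IHu vin; constructor; last exact: IHu. Qed.

Lemma tensors_in_tmap (A : {pred R}) f k u :
  (forall w, w \is a polyOver A -> f w \is a polyOver A) ->
  tensors_in m X A k u -> tensors_in m X A k (tmap f id u).
Proof.
by move=> fA; elim=> [|[w T] {}u [wA cT] _ IHu]; constructor => //; split; [exact: fA|].
Qed.

Lemma log_eq_refl k T : log_eq m X D k T T.
Proof. by rewrite /log_eq subrr. Qed.

Lemma log_eq_lin k (a : R[i]) T T' S S' : log_eq m X D k T T' ->
  log_eq m X D k S S' -> log_eq m X D k (a *: T + S) (a *: T' + S').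
Proof.
rewrite /log_eq opprD addrACA -scalerBr; exact: on_D_lin.
Qed.

Lemma eq_tensors k u v :
  (forall l, contract (fun w => w`_l) u = contract (fun w => w`_l) v) ->
  tensors_eq m X D k u v.
Proof. by move=> eq_uv l; rewrite eq_uv; exact: log_eq_refl. Qed.

Lemma log_eq_trans k T S U :
  log_eq m X D k T S -> log_eq m X D k S U -> log_eq m X D k T U.
Proof.
rewrite /log_eq => TS SU; have := on_D_lin 1 TS SU.
by rewrite scale1r addrA subrK.
Qed.

Lemma log_eq_sym k T S : log_eq m X D k T S -> log_eq m X D k S T.
Proof.
rewrite /log_eq => TS; have := on_D_lin (-1) TS (@on_D0 k).
by rewrite addr0 scaleN1r opprB.
Qed.

End Currents.

(** * The maps [ev] and [s] as morphisms of complexes *)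

Section Deligne.
Variables (R : realType) (N m : nat) (X D : set 'rV[R[i]]_N.+1).
Variables (A : subringClosed R) (p : int).
Hypothesis hQA : forall q : rat, (ratr q : R) \in A.
Local Notation contract := Defs.contract.
Local Notation cur := (functional R N).
Local Notation P := (P_D m X D A p).
Local Notation C := (C_D m X D A p).
Local Notation ev := (ev_map m X D A p).
Local Notation s := (s_map m X D A p).
Local Notation integral := 
  (fun w : {poly R} => \int[lebesgue_measure]_(t in `[0, 1]) w.[t]).

Lemma ev_add (u v : car P) : ev (add_cplx u v) = add_cplx (ev u) (ev v).
Proof. by case: u v => [u0 u1] [v0 v1]; rewrite /= !contract_cat. Qed.

Lemma contract_tmapZ (phi : {scalar {poly R}}) (a : R) (u : tensors R N) :
  contract phi (tmap ( *:%R a) id u) = a%:C *: contract phi u.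
Proof.
rewrite contract_tmapl -[RHS]addr0 -(contract0 u) -contract_lin.
by apply: eq_contract => w /=; rewrite linearZ addr0.
Qed.

Lemma contract_integral (u : tensors R N) :
  contract integral u = contract (horner_eval 1 \o @primitive R) u.
Proof. by apply: eq_contract => w /=; rewrite Rintegral_horner. Qed.

Lemma ev_scale (a : R) (u : car P) : ev (scale_cplx a u) = scale_cplx a (ev u).
Proof.
case: u => u0 u1; rewrite /= !contract_integral.
by rewrite (contract_tmapZ (horner_eval 0)) (contract_tmapZ (horner_eval 1))
  (contract_tmapZ (horner_eval 1 \o @primitive R)).
Qed.

Lemma ev_dif n (u : car P) : ev (dif n u) = dif n (ev u).
Proof.
case: u => u0 u1; rewrite /= !contract_cat !contract_tmapr !contract_tmapl.
congr (_, _, _ + _).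
  rewrite -contractN -[contract (horner^~ 1) u0]scale1r addrC -contract_lin.
  by apply: eq_contract => w /=; rewrite Rintegral_horner primitive_deriv !hornerE.
rewrite -cur_dN -contractN; congr cur_d.
apply: eq_contract => w /=.
by rewrite !Rintegral_horner linearN hornerN.
Qed.

Lemma eqv_ev n (u v : car P) : eqv n u v -> eqv n (ev u) (ev v).
Proof.
case: u v => [u0 u1] [v0 v1] [eq0 eq1] /=; rewrite !contract_integral.
split; [exact: (log_eq_contract (horner_eval 0))
  |exact: (log_eq_contract (horner_eval 1))
  |exact: (log_eq_contract (horner_eval 1 \o @primitive R))].
Qed.

Lemma eqv_C_refl n (c : car C) : eqv n c c.
Proof. by case: c => [[a b] c]; split; exact: log_eq_refl. Qed.

Lemma mem_ev n (u : car P) : mem_cplx n u -> mem_cplx n (ev u).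
Proof.
by case: u => u0 u1 [_ u1in int0 F1]; split=> //; exact: is_current_contract u1in.
Qed.

Lemma ev_s (c : car C) : ev (s c) = c.
Proof.
case: c => [[a b] c]; rewrite /= !contract_cons !contract_nil !addr0.
rewrite Rintegral_horner primitive1 !hornerE subrr subr0.
by rewrite rmorph1 rmorph0 !scale1r !scale0r addr0 add0r.
Qed.

Lemma mem_s n (c : car C) : mem_cplx n c -> mem_cplx n (s c).
Proof.
(* The endpoint values of [s c], on which the integrality and Hodge conditions bear, are the first
   two components of [ev (s c) = c]. *)
move=> cin; have := ev_s c; case: c cin => [[a b] c] [Ia Fb cc] [/= -> -> _].
split=> //; constructor.
- by split; [rewrite rpredB ?polyOverX ?rpred1|case: Ia].
- by constructor=> //; split; [exact: polyOverX|case: Fb].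
- by split=> //; exact: rpred1.
- by [].
Qed.

Lemma eqv_s n (c c' : car C) : eqv n c c' -> eqv n (s c) (s c').
Proof.
case: c c' => [[a b] c] [[a' b'] c'] [ea eb ec].
split=> l /=; rewrite !contract_cons !contract_nil.
  by do 2!apply: log_eq_lin => //; exact: log_eq_refl.
by apply: log_eq_lin => //; exact: log_eq_refl.
Qed.

Lemma s_add n (c c' : car C) : eqv n (s (add_cplx c c')) (add_cplx (s c) (s c')).
Proof.
case: c c' => [[a b] c] [[a' b'] c'].
split; apply: eq_tensors => l; rewrite /= !contract_cons !contract_nil !addr0.
  by rewrite !scalerDr addrACA -addrA.
by rewrite scalerDr.
Qed.

Lemma s_scale n (r : R) (c : car C) : eqv n (s (scale_cplx r c)) (scale_cplx r (s c)).
Proof.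
case: c => [[a b] c]; split; apply: eq_tensors => l.
all: rewrite /= !contract_cons !contract_nil !addr0 !coefZ !rmorphM !scalerA.
all: by rewrite ![r%:C * _]mulrC.
Qed.

(** Only an equivalence: the [dx]-component is a single tensor on the left and a list of three on
    the right. *)
Lemma s_dif n (c : car C) : eqv (n + 1) (s (dif n c)) (dif n (s c)).
Proof.
case: c => [[a b] c]; split; apply: eq_tensors => l.
all: rewrite /= !contract_cons !contract_nil !addr0 //.
rewrite derivB derivX derivC sub0r coefN rmorphN !scaleNr.
by rewrite !scalerDr !scalerN addrA.
Qed.

(** * The homotopy from [s o ev] to the identity *)

Definition fill (t : tensors R N) : tensors R N * tensors R N :=
  (tmap (@bubble R) id t, [::]).

(** Bubbles vanish at 0 and 1, so the sum has exactly the endpoint values of [w] and inherits its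
    integrality and Hodge conditions. *)
Lemma mem_fill n (w : car P) t : mem_cplx n w -> tensors_in m X A n t ->
  mem_cplx n (add_cplx w (fill t : car P)).
Proof.
case: w => w0 w1 [w0in w1in Iw Fw] tin; rewrite /= cats0 !contract_cat.
have -> : contract (horner^~ 0) (tmap (@bubble R) id t) = 0.
  by rewrite contract_tmapl -(contract0 t); apply: eq_contract => w; exact: bubble0.
have -> : contract (horner^~ 1) (tmap (@bubble R) id t) = 0.
  by rewrite contract_tmapl -(contract0 t); apply: eq_contract => w; exact: bubble1.
rewrite !addr0; split=> //; apply: tensors_in_cat => //.
by apply: tensors_in_tmap tin => w; exact: bubble_polyOver.
Qed.

Lemma dif_lin n (a : R) (u v : car P) :
  eqv (n + 1) (dif n (add_cplx (scale_cplx a u) v))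
    (add_cplx (scale_cplx a (dif n u)) (dif n v)).
Proof.
case: u v => [u0 u1] [v0 v1]; split; apply: eq_tensors => l /=.
  rewrite contract_cat !contract_tmapr contract_cat !(contract_tmapZ (coefp l)).
  by rewrite contract_tmapr cur_dD cur_dZ.
rewrite !(contract_cat, contract_tmapr) (contract_tmapZ (coefp l)).
rewrite !(contract_cat, contract_tmapr, contract_tmapl _ (@deriv R)).
rewrite (contract_tmapZ (coefp l \o @deriv R)) (contract_tmapZ (coefp l \o -%R)).
by rewrite cur_dD cur_dZ scalerDr addrACA.
Qed.

Lemma eqv_trans n (u v w : car P) : eqv n u v -> eqv n v w -> eqv n u w.
Proof.
case: u v w => [u0 u1] [v0 v1] [w0 w1] [uv0 uv1] [vw0 vw1].
by split=> l; [exact: log_eq_trans (uv0 l) (vw0 l)|exact: log_eq_trans (uv1 l) (vw1 l)].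
Qed.

Lemma eqv_lin n (a : R) (u u' v v' : car P) : eqv n u u' -> eqv n v v' ->
  eqv n (add_cplx (scale_cplx a u) v) (add_cplx (scale_cplx a u') v').
Proof.
case: u u' v v' => [u0 u1] [u'0 u'1] [v0 v1] [v'0 v'1] [eu0 eu1] [ev0 ev1].
split=> l; rewrite !contract_cat !(contract_tmapZ (coefp l)).
  exact: log_eq_lin (eu0 l) (ev0 l).
exact: log_eq_lin (eu1 l) (ev1 l).
Qed.

(* [bubble] applied to the [dx]-component of [du] measures how far [u] is from
   [s (ev u) + d (fill u.2)]. *)
Lemma homotopy n (u : car P) : eqv (n + 1) (dif n u) (zero_cplx P) ->
  eqv n u (add_cplx (s (ev u)) (dif (n - 1) (fill u.2 : car P))).
Proof.
case: u => u0 u1 [_ /= du]; split=> l /=; last first.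
  (* In the [dx]-component the identity is [deriv_bubble], coefficient by coefficient. *)
  rewrite cats0 contract_cons !contract_tmapl -contract_lin.
  rewrite [X in log_eq _ _ _ _ _ X](eq_contract (psi := coefp l)).
    exact: log_eq_refl.
  move=> w /=; rewrite Rintegral_horner deriv_bubble coefB !coefC.
  by case: eqP => _; rewrite ?mul1r ?mul0r ?subr0 ?add0r // addrC subrK.
have := log_eq_contract (coefp l \o @bubble R) du.
rewrite addrK contract_nil !(contract_cat, contract_tmapr, contract_tmapl) !contract_cons.
rewrite contract_tmapr contract_tmapl /log_eq subr0 => dbubble.
(* The inserted 0 is read as the contraction of [u0] with weight 0, so that [contract_lin] can fold
   both endpoint terms into one contraction. *)
rewrite addrA -[(_ *: contract (horner^~ 1) u0)]addr0.
rewrite -(contract0 u0) -!contract_lin opprD addrA -contractN.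
rewrite -[contract _ u0 in X in on_D _ _ _ _ X]scale1r -contract_lin.
rewrite -cur_dN -contractN (eq_contract (psi := coefp l \o @bubble R \o @deriv R)).
  suff -> : contract (fun w => - (bubble w)`_l) u1 =
            contract (coefp l \o @bubble R \o -%R) u1 by [].
  by apply: eq_contract => w /=; rewrite linearN coefN.
move=> w /=; rewrite bubble_deriv [RHS]coefB [in RHS]coefD !coefZ mul1r addr0.
by rewrite ![_.[_] * _]mulrC.
Qed.

(** * Passage to cohomology *)

Lemma eqv_sym n (u v : car P) : eqv n u v -> eqv n v u.
Proof.
by case: u v => [u0 u1] [v0 v1] [uv0 uv1]; split=> l; exact: log_eq_sym.
Qed.

Lemma eqv_refl n (u : car P) : eqv n u u.
Proof. by case: u => [u0 u1]; split=> l; exact: log_eq_refl. Qed.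

Lemma scale1_cplx (u : car P) : scale_cplx 1 u = u.
Proof.
by case: u => u0 u1; congr (_, _); apply: map_id_in => -[w T] _ /=; rewrite scale1r.
Qed.

Lemma eqv_add n (u u' v v' : car P) : eqv n u u' -> eqv n v v' ->
  eqv n (add_cplx u v) (add_cplx u' v').
Proof. by move=> eu ev; have := eqv_lin 1 eu ev; rewrite !scale1_cplx. Qed.

Lemma dif_add n (u v : car P) :
  eqv (n + 1) (dif n (add_cplx u v)) (add_cplx (dif n u) (dif n v)).
Proof. by have := dif_lin n 1 u v; rewrite !scale1_cplx. Qed.

Lemma eqv_addNK n (u v : car P) :
  eqv n u (add_cplx v (add_cplx (scale_cplx (-1) v) u)).
Proof.
case: u v => [u0 u1] [v0 v1]; split; apply: eq_tensors => l.
all: rewrite !contract_cat (contract_tmapZ (coefp l)) rmorphN scaleN1r.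
all: by rewrite addrA subrr add0r.
Qed.

Lemma eqv_dif0_lin n (a : R) (u v : car P) :
  eqv (n + 1) (dif n u) (zero_cplx P) -> eqv (n + 1) (dif n v) (zero_cplx P) ->
  eqv (n + 1) (dif n (add_cplx (scale_cplx a u) v)) (zero_cplx P).
Proof. by move=> du dv; apply: eqv_trans (dif_lin _ _ _ _) (eqv_lin a du dv). Qed.

(** The difference [z] of [u] and [v] is closed and [ev z] is equivalent to [d w], so [s (ev z)] is
    equivalent to [d (s w)]; the homotopy then carries this over to [z]. *)
Lemma cohomologous_ev n (u v : car P) : cocycle n u -> cocycle n v ->
  cohomologous n (ev u) (ev v) -> cohomologous n u v.
Proof.
move=> [uin du] [vin dv] [w win ev_uv].
pose z := add_cplx (scale_cplx (-1) v) u.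
have zin : tensors_in m X A (n - 1) z.2.
  rewrite /z; case: (u) (v) uin vin => [u0 u1] [v0 v1] [_ u1in _ _] [_ v1in _ _].
  apply: tensors_in_cat => //; apply: tensors_in_tmap v1in => f fA.
  by rewrite scaleN1r rpredN.
have ev_z : eqv n (ev z) (dif (n - 1) w).
  rewrite ev_add ev_scale.
  case: (ev u) (ev v) (dif _ w) ev_uv => [[a b] c] [[a' b'] c'] [[a'' b''] c''] /=.
  rewrite /log_eq => -[ea eb ec].
  by split; rewrite /log_eq rmorphN scaleN1r [- _ + _]addrC -addrA -opprD.
have s_ev_z : eqv n (s (ev z)) (dif (n - 1) (s w)).
  by have := s_dif (n - 1) w; rewrite subrK; apply: eqv_trans (eqv_s ev_z).
(* [s w] bounds [s (ev z)], and the filling bounds what separates [z] from [s (ev z)]. *)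
exists (add_cplx (s w) (fill z.2 : car P)); first exact: mem_fill (mem_s win) zin.
apply: (eqv_trans (eqv_addNK n u v)); apply: eqv_add (eqv_refl n v) _.
apply: (eqv_trans (homotopy (eqv_dif0_lin (-1) dv du))).
apply: (eqv_trans (eqv_add s_ev_z (eqv_refl n _))); apply: eqv_sym.
by have := dif_add (n - 1) (s w) (fill z.2); rewrite subrK.
Qed.

Lemma cocycle_ev n (u : car P) : cocycle n u -> cocycle n (ev u).
Proof.
move=> [uin du]; split; first exact: mem_ev.
by rewrite -ev_dif; have := eqv_ev du; rewrite /= !contract_nil.
Qed.

(** [s] sends zero to nonempty lists of tensors with zero currents, which agree with the empty lists
    only up to [eqv]. *)
Lemma eqv_s0 n : eqv n (s (zero_cplx C)) (zero_cplx P).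
Proof.
by split; apply: eq_tensors => l; rewrite !contract_cons !contract_nil !scaler0 !addr0.
Qed.

Lemma cocycle_s n (c : car C) : cocycle n c -> cocycle n (s c).
Proof.
move=> [cin dc]; split; first exact: mem_s.
exact: eqv_trans (eqv_sym (s_dif n c)) (eqv_trans (eqv_s dc) (eqv_s0 _)).
Qed.

Lemma cohomologous_refl n (c : car C) : cohomologous n c c.
Proof.
exists (zero_cplx C).
  by split; [exact: rel_integral0|exact: hodge_F0|exact: is_current0].
suff -> : add_cplx c (dif (n - 1) (zero_cplx C)) = c by exact: eqv_C_refl.
by case: c => [[a b] c] /=; rewrite !cur_d0 oppr0 !addr0.
Qed.

Lemma ev_morphism : cplx_morphism A ev.
Proof.
split=> [n u|n u v _ _|n u v _ _|n a u _ _|n u _].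
- exact: mem_ev.
- exact: eqv_ev.
- by rewrite ev_add; exact: eqv_C_refl.
- by rewrite ev_scale; exact: eqv_C_refl.
- by rewrite ev_dif; exact: eqv_C_refl.
Qed.

Lemma s_morphism : cplx_morphism A s.
Proof.
split=> [n c|n c c' _ _|n c c' _ _|n a c _ _|n c _].
- exact: mem_s.
- exact: eqv_s.
- exact: s_add.
- exact: s_scale.
- exact: s_dif.
Qed.

(** A right inverse of an injective map is two-sided: [s (ev u)] and [u] have the same image under
    [ev], which is injective on cohomology. *)
Lemma ev_s_quasi_inverse : quasi_inverse ev s.
Proof.
move=> n; split=> [u uZ|c _]; last by rewrite ev_s; exact: cohomologous_refl.
apply: (cohomologous_ev (cocycle_s (cocycle_ev uZ)) uZ).
by rewrite ev_s; exact: cohomologous_refl.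
Qed.

Lemma ev_quasi_isomorphism : quasi_isomorphism A ev.
Proof.
split=> [|n]; first exact: ev_morphism.
split=> [u v|c cZ]; first exact: cohomologous_ev.
exists (s c); first exact: cocycle_s.
by rewrite ev_s; exact: cohomologous_refl.
Qed.

End Deligne.

Theorem lemma3 (R : realType) (N m : nat) (X D : set 'rV[R[i]]_N.+1)
    (A : {pred R}) (p : int)
    (hA : GRing.subring_closed A)
    (hQA : forall q : rat, (ratr q : R) \in A)
    (hX : smooth_projective m X)
    (hD : normal_crossing_divisor m X D) :
  [/\ quasi_isomorphism A (ev_map m X D A p),
      cplx_morphism A (s_map m X D A p)
    & quasi_inverse (ev_map m X D A p) (s_map m X D A p)].
Proof.
(* The bare predicate is bundled with its closure properties, the form in which the section takes
   [A]. *)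
pose S : subringClosed R :=
  HB.pack_for (subringClosed R) A (GRing.isSubringClosed.Build R A hA).
split; [exact: (@ev_quasi_isomorphism _ _ _ _ _ S)|exact: (@s_morphism _ _ _ _ _ S)
  |exact: (@ev_s_quasi_inverse _ _ _ _ _ S)].
Qed.
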